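(* The following assertions hold, where $A$ is a Banach algebra. (1) Let $B$ be a Banach left $A$-module and let $X=\{a''\in A^{**}: B^*a''\subseteq B^*\}$. Then $Z^\ell_{B^{**}}(A^{**})\,X\subseteq Z^\ell_{B^{**}}(A^{**})$. (2) Let $B$ be a Banach right $A$-module. Then $Z^\ell_{A^{**}}(B^{**})\,Z_1(A^{**})\subseteq Z^\ell_{A^{**}}(B^{**})$. If $B$ is a unital Banach $A$-module, then $Z^\ell_{A^{**}}(B^{**})\,Z_1(A^{**})=Z^\ell_{A^{**}}(B^{**})$. (3) Let $B\subseteq A$ be a Banach space such that $B$ is a Banach left $A$-module. If $A$ is Arens regular, then $Z^\ell_{B^{**}}(A^{**})=A^{**}$. (4) Suppose that $B$ is a Banach space containing the Banach algebra $A$ such that $B$ is a Banach left $A$-module. If $A$ is strongly Arens irregular, then $Z^\ell_{B^{**}}(A^{**})=A$.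
   Context: For a bounded bilinear map $m:X\times Y\to Z$ of normed spaces define $m^*:Z^*\times X\to Y^*$, $m^{**}:Y^{**}\times Z^*\to X^*$, $m^{***}:X^{**}\times Y^{**}\to Z^{**}$ by $\langle m^*(z',x),y\rangle=\langle z',m(x,y)\rangle$, $\langle m^{**}(y'',z'),x\rangle=\langle y'',m^*(z',x)\rangle$, $\langle m^{***}(x'',y''),z'\rangle=\langle x'',m^{**}(y'',z')\rangle$. Let $m^t(y,x)=m(x,y)$ and $m^{t***t}(x'',y'')=(m^t)^{***}(y'',x'')$. Applied to the multiplication of $A$, $m^{***}$ is the first Arens product on $A^{**}$, written $a''b''$, and $m^{t***t}$ is the second Arens product, written $a''\circ b''$. Applied to the module actions $\pi_\ell(a,b)=ab$ and $\pi_r(b,a)=ba$, the first extension gives $a''b''=\pi_\ell^{***}(a'',b'')$ and $b''a''=\pi_r^{***}(b'',a'')$ in $B^{**}$. For $b'\in B^*$ and $a''\in A^{**}$, the functional $b'a''\in B^{***}$ is defined by $\langle b'a'',b''\rangle=\langle a''b'',b'\rangle$; $B^*$ is identified with its canonical image in $B^{***}$, and $A$ with its canonical image in $A^{**}$. $Z_1(A^{**})=\{a''\in A^{**}: b''\mapsto a''b''\text{ is weak}^*\text{-to-weak}^*\text{ continuous on }A^{**}\}$; $Z_2(A^{**})=\{b''\in A^{**}: a''\mapsto a''\circ b''\text{ is weak}^*\text{-to-weak}^*\text{ continuous on }A^{**}\}$; $Z^\ell_{B^{**}}(A^{**})=\{a''\in A^{**}: b''\mapsto a''b'',\ B^{**}\to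 B^{**},\text{ is weak}^*\text{-to-weak}^*\text{ continuous}\}$; $Z^\ell_{A^{**}}(B^{**})=\{b''\in B^{**}: a''\mapsto b''a'',\ A^{**}\to B^{**},\text{ is weak}^*\text{-to-weak}^*\text{ continuous}\}$. $A$ is Arens regular if the two Arens products on $A^{**}$ coincide (equivalently $Z_1(A^{**})=A^{**}$). $A$ is left (respectively right) strongly Arens irregular if $Z_1(A^{**})=A$ (respectively $Z_2(A^{**})=A$), and strongly Arens irregular if it is both. For sets $S,T$, $ST=\{st:s\in S,t\in T\}$. $B$ is a unital Banach $A$-module if $A$ acts on both sides of $B$ and there is $e\in A$ with $eb=be=b$ for all $b\in B$. *)

(* Defs.v *)
From HB Require Import structures.
From mathcomp Require Import all_boot all_order all_algebra sesquilinear complex.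
From mathcomp Require Import all_classical all_reals topology normedtype.
Set Implicit Arguments.
Unset Strict Implicit.
Unset Printing Implicit Defensive.
Import Order.TTheory GRing.Theory Num.Theory.
Import numFieldNormedType.Exports.
Local Open Scope classical_set_scope.
Local Open Scope ring_scope.

(* The scalars are R or R[i]; the Boolean lets one statement cover both. *)
Definition scalar_field (R : realType) (is_complex : bool) : numFieldType :=
  if is_complex return numFieldType then (R[i] : numFieldType)
  else (R : numFieldType).

Definition real_scalar (R : realType) (c : bool) : R -> scalar_field R c :=
  match c return R -> scalar_field R c with
  | true => fun x => (x%:C)%C
  | false => fun x => x
  end.
Arguments real_scalar {R} c.

Section real_scalar_lemmas.
Variables (R : realType) (c : bool).
Implicit Types x y : R.

Lemma real_scalar_le x y : (real_scalar c x <= real_scalar c y) = (x <= y).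
Proof. by case: c => //=; rewrite lecR. Qed.

Lemma real_scalar0 : real_scalar c (0 : R) = 0.
Proof. by case: c. Qed.

Lemma real_scalar_ge0 (k : scalar_field R c) :
  0 <= k -> exists x, real_scalar c x = k.
Proof.
case: c k => /= k k0; last by exists k.
by exists (complex.Re k); rewrite RRe_real// ger0_real.
Qed.

End real_scalar_lemmas.

Section dual_space.
Variables (R : realType) (c : bool).
Local Notation K := (scalar_field R c).
Variable E : normedModType K.

Definition continuous_linear : {pred (E -> K^o)} :=
  [pred f | `[< linear f /\ continuous f >]].

Lemma continuous_linearP (f : E -> K^o) :
  f \in continuous_linear <-> linear f /\ continuous f.
Proof. by split=> [/asboolP//|lcf]; apply/asboolP. Qed.

Record dual := Dual {
  dual_fun :> E -> K^o ;
  dual_funP : dual_fun \in continuous_linear }.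

HB.instance Definition _ := [isSub for dual_fun].
HB.instance Definition _ := [Choice of dual by <:].

Lemma continuous_linear_submod : submod_closed continuous_linear.
Proof.
split=> [|a f g].
  apply/continuous_linearP; split; last by move=> x; exact: cst_continuous.
  by move=> a u v; rewrite scaler0 addr0.
move=> /continuous_linearP[lf cf] /continuous_linearP[lg cg].
apply/continuous_linearP; split.
  move=> k u v; rewrite !fctE lf lg.
  by rewrite !scalerDr !scalerA (mulrC a k) addrACA.
move=> x; apply: continuousD; last exact: cg.
by apply: continuousZl_tmp; exact: cf.
Qed.

HB.instance Definition _ := GRing.isSubmodClosed.Build K (E -> K^o)
  continuous_linear continuous_linear_submod.
HB.instance Definition _ := [SubChoice_isSubLmodule of dual by <:].

Lemma dual_linear (f : dual) : linear f.
Proof. by have /continuous_linearP[] := dual_funP f. Qed.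

HB.instance Definition _ (f : dual) :=
  GRing.isLinear.Build K E K^o *:%R (dual_fun f) (@dual_linear f).

Lemma dual_continuous (f : dual) : continuous f.
Proof. by have /continuous_linearP[] := dual_funP f. Qed.

Lemma dual_ext (f g : dual) : f =1 g -> f = g.
Proof. by move=> fg; apply/val_inj/funext. Qed.

Definition dual_norm (f : dual) : K :=
  real_scalar c (sup [set r | exists2 x : E, `|x| <= 1 & real_scalar c r = `|f x|]).

Lemma dual_bounded (f : dual) :
  exists2 M : R, 0 <= M & forall x, `|f x| <= real_scalar c M * `|x|.
Proof.
have /linear_bounded_continuous/linear_boundedP := @dual_continuous f.
move=> /pinfty_ex_gt0[M M0 fM].
have [r rM] := real_scalar_ge0 (ltW M0).
exists r; last by rewrite rM.
by rewrite -(real_scalar_le c) rM real_scalar0 ltW.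
Qed.

Let ball_values (f : dual) :=
  [set r | exists2 x : E, `|x| <= 1 & real_scalar c r = `|f x|].

Let ball_values_sup (f : dual) : has_sup (ball_values f).
Proof.
split; first by exists 0, 0; rewrite ?normr0 ?ler01// linear0 normr0 real_scalar0.
have [M M0 fM] := dual_bounded f; exists M => r [x x1 rE].
rewrite -(real_scalar_le c) rE (le_trans (fM x))// ler_piMr//.
by rewrite -(real_scalar0 R c) real_scalar_le.
Qed.

Lemma dual_norm_ge0 (f : dual) : 0 <= dual_norm f.
Proof.
rewrite -(real_scalar0 R c) real_scalar_le; apply: sup_upper_bound.
  exact: ball_values_sup.
by exists 0; rewrite ?normr0 ?ler01// linear0 normr0 real_scalar0.
Qed.

Lemma dual_norm_bound (f : dual) x : `|f x| <= dual_norm f * `|x|.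
Proof.
have [->|x0] := eqVneq x 0; first by rewrite linear0 !normr0 mulr0.
have nx0 : 0 < `|x| by rewrite normr_gt0.
rewrite -ler_pdivrMr//.
have fE : `|f x| / `|x| = `|f (`|x|^-1 *: x)|.
  by rewrite linearZ/= normrZ normfV normr_id mulrC.
have [r rE] := real_scalar_ge0 (normr_ge0 (f (`|x|^-1 *: x))).
rewrite fE -rE real_scalar_le; apply: sup_upper_bound.
  exact: ball_values_sup.
exists (`|x|^-1 *: x) => //.
by rewrite normrZ normfV normr_id mulVf// gt_eqF.
Qed.

Lemma dual_norm_le (f : dual) (M : K) : 0 <= M ->
  (forall x, `|f x| <= M * `|x|) -> dual_norm f <= M.
Proof.
move=> M0 fM; have [m mE] := real_scalar_ge0 M0.
rewrite -mE real_scalar_le; apply: ge_sup; first by case: (ball_values_sup f).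
move=> r [x x1 rE]; rewrite -(real_scalar_le c) rE mE.
by rewrite (le_trans (fM x))// ler_piMr.
Qed.

Lemma dual_normD (f g : dual) : dual_norm (f + g) <= dual_norm f + dual_norm g.
Proof.
apply: dual_norm_le => [|x]; first by rewrite addr_ge0 ?dual_norm_ge0.
by rewrite mulrDl (le_trans (ler_normD _ _))// lerD// dual_norm_bound.
Qed.

Lemma dual_normZ (k : K) (f : dual) : dual_norm (k *: f) = `|k| * dual_norm f.
Proof.
have le_normZ a g : dual_norm (a *: g) <= `|a| * dual_norm g.
  apply: dual_norm_le => [|x]; first by rewrite mulr_ge0 ?dual_norm_ge0.
  by rewrite [X in `|X|](_ : _ = a * g x)// normrM -mulrA ler_wpM2l ?dual_norm_bound.
apply/eqP; rewrite eq_le le_normZ/=.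
have [->|k0] := eqVneq k 0; first by rewrite normr0 mul0r dual_norm_ge0.
rewrite -ler_pdivlMl ?normr_gt0// -normfV.
by rewrite -[X in dual_norm X](scalerK k0) le_normZ.
Qed.

Lemma dual_norm0_eq0 (f : dual) : dual_norm f = 0 -> f = 0.
Proof.
move=> f0; apply: dual_ext => x; apply/eqP; rewrite -normr_le0.
by rewrite (le_trans (dual_norm_bound f x))// f0 mul0r.
Qed.

HB.instance Definition _ :=
  Lmodule_isNormed.Build K dual dual_normD dual_normZ dual_norm0_eq0.

End dual_space.
Arguments continuous_linear {R c} E.

Definition weak_star (R : realType) (c : bool)
    (E : normedModType (scalar_field R c)) :=
  initial_topology
    (fun f : dual E => (dual_fun f : {ptws E -> (scalar_field R c)^o})).

Definition weak_star_continuous (R : realType) (c : bool)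
    (E F : normedModType (scalar_field R c)) (g : dual E -> dual F) :=
  continuous (g : weak_star E -> weak_star F).

Section bounded_bilinear.
Variables (R : realType) (c : bool).
Local Notation K := (scalar_field R c).

Lemma bounded_dual (E : normedModType K) (f : E -> K^o) (M : K) :
  linear f -> (forall x, `|f x| <= M * `|x|) -> f \in continuous_linear E.
Proof.
move=> lf fM; apply/continuous_linearP; split=> //.
pose g : {linear E -> K^o} := HB.pack f (GRing.isLinear.Build _ _ _ _ f lf).
apply: (@bounded_linear_continuous _ _ _ g); apply/ex_bound.
exists `|M|; apply/nbhs_norm0P; exists 1 => //= x /= /ltW x1.
have := fM x; have [->|x0] := eqVneq x 0.
  by move=> _; rewrite -[f 0]/(g 0) linear0 normr0.
move=> fxM; have M0 : 0 <= M.
  by rewrite -(@pmulr_lge0 _ `|x|) ?normr_gt0// (le_trans _ fxM).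
by rewrite (le_trans fxM)// ger0_norm// ler_piMr.
Qed.

Record bounded_bilinear (X Y Z : normedModType K) := BoundedBilinear {
  bilinear_fun :> {bilinear X -> Y -> Z} ;
  bilinear_bounded :
    exists M : K, forall x y, `|bilinear_fun x y| <= M * `|x| * `|y| }.

Lemma bilinear_bounded_ge0 (X Y Z : normedModType K)
    (m : bounded_bilinear X Y Z) :
  exists2 M : K, 0 <= M & forall x y, `|m x y| <= M * `|x| * `|y|.
Proof.
have [M mM] := bilinear_bounded m.
have [[x [y [x0 y0]]]|nxy] := pselect (exists x : X, exists y : Y, x != 0 /\ y != 0).
  exists M => //; have := mM x y; rewrite -mulrA => /(le_trans (normr_ge0 _)).
  by rewrite pmulr_lge0// mulr_gt0// normr_gt0.
exists 0 => // x y; rewrite !mul0r normr_le0.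
have [->|x0] := eqVneq x 0; first by rewrite linear0l.
have [->|y0] := eqVneq y 0; first by rewrite linear0r.
by exfalso; apply: nxy; exists x, y.
Qed.

Definition flip_fun (X Y Z : normedModType K) (m : bounded_bilinear X Y Z)
  (y : Y) (x : X) : Z := m x y.

Lemma flip_bilinear (X Y Z : normedModType K) (m : bounded_bilinear X Y Z) :
  bilinear_for *:%R *:%R (flip_fun m).
Proof. by split=> z a u v; [exact: linearPr|exact: linearPl]. Qed.

HB.instance Definition _ (X Y Z : normedModType K)
    (m : bounded_bilinear X Y Z) :=
  bilinear_isBilinear.Build K Y X Z *:%R *:%R (flip_fun m) (flip_bilinear m).

Lemma flip_bounded (X Y Z : normedModType K) (m : bounded_bilinear X Y Z) :
  exists M : K, forall y x, `|flip_fun m y x| <= M * `|y| * `|x|.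
Proof.
by have [M mM] := bilinear_bounded m; exists M => y x; rewrite mulrAC; exact: mM.
Qed.

(* m^t *)
Definition flip (X Y Z : normedModType K) (m : bounded_bilinear X Y Z) :
  bounded_bilinear Y X Z := BoundedBilinear (flip_bounded m).

Section adjoint.
Variables (X Y Z : normedModType K) (m : bounded_bilinear X Y Z).

Lemma adjoint_dual (z' : dual Z) (x : X) :
  (fun y => z' (m x y)) \in continuous_linear Y.
Proof.
have [M M0 mM] := bilinear_bounded_ge0 m.
apply: (@bounded_dual _ _ (`|z'| * (M * `|x|))) => [a u v|y].
  by rewrite linearPr linearP.
rewrite (le_trans (dual_norm_bound z' (m x y)))// -mulrA.
by rewrite ler_wpM2l ?dual_norm_ge0// mM.
Qed.

Definition adjoint_fun (z' : dual Z) (x : X) : dual Y :=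
  Dual (adjoint_dual z' x).

Lemma adjoint_bilinear : bilinear_for *:%R *:%R adjoint_fun.
Proof.
split=> [x a u v|z' a u v]; apply: dual_ext => y //=.
by rewrite linearPl linearP.
Qed.

HB.instance Definition _ := bilinear_isBilinear.Build K (dual Z) X (dual Y)
  *:%R *:%R adjoint_fun adjoint_bilinear.

Lemma adjoint_bounded :
  exists M : K, forall z' x, `|adjoint_fun z' x| <= M * `|z'| * `|x|.
Proof.
have [M M0 mM] := bilinear_bounded_ge0 m.
exists M => z' x; apply: dual_norm_le => [|y]; first by rewrite !mulr_ge0.
rewrite (le_trans (dual_norm_bound z' (m x y)))//.
rewrite (mulrC M) -!mulrA ler_wpM2l ?dual_norm_ge0// mulrA; exact: mM.
Qed.

(* m^* *)
Definition adjoint : bounded_bilinear (dual Z) X (dual Y) :=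
  BoundedBilinear adjoint_bounded.

Lemma adjointE z' x y : adjoint z' x y = z' (m x y).
Proof. by []. Qed.

End adjoint.

(* m^*** *)
Definition arens_ext (X Y Z : normedModType K) (m : bounded_bilinear X Y Z) :
    bounded_bilinear (dual (dual X)) (dual (dual Y)) (dual (dual Z)) :=
  adjoint (adjoint (adjoint m)).

(* m^{t***t} *)
Definition arens_ext_t (X Y Z : normedModType K) (m : bounded_bilinear X Y Z) :
    bounded_bilinear (dual (dual X)) (dual (dual Y)) (dual (dual Z)) :=
  flip (arens_ext (flip m)).

(* With [m] the multiplication of A this is Z_1(A^** ); with [m] a left
   (resp. right) action of A on B it is Z^l_{B^**}(A^** )
   (resp. Z^l_{A^**}(B^** )). *)
Definition left_center (X Y Z : normedModType K) (m : bounded_bilinear X Y Z) :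
    set (dual (dual X)) :=
  [set x | weak_star_continuous (fun y => arens_ext m x y)].

(* With [m] the multiplication of A this is Z_2(A^** ). *)
Definition right_center (X Y Z : normedModType K) (m : bounded_bilinear X Y Z) :
    set (dual (dual Y)) :=
  [set y | weak_star_continuous (fun x => arens_ext_t m x y)].

Section bidual_embedding.
Variables (E : normedModType K).

Lemma bidual_embed_dual (x : E) : (fun f : dual E => f x) \in continuous_linear (dual E).
Proof.
apply: (@bounded_dual _ _ `|x|) => // f.
by rewrite mulrC; exact: dual_norm_bound.
Qed.

Definition bidual_embed (x : E) : dual (dual E) := Dual (bidual_embed_dual x).

End bidual_embedding.

(* The multiplication of a Banach algebra is carried as a bounded bilinear map
   because the algebra need not have a unit, unlike MathComp's algebras. *)
Definition is_banach_algebra (A : completeNormedModType K)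
    (mul : bounded_bilinear A A A) :=
  (forall a b d, mul a (mul b d) = mul (mul a b) d) /\
  (forall a b, `|mul a b| <= `|a| * `|b|).

Section modules.
Variables (A B : completeNormedModType K) (mul : bounded_bilinear A A A).

Definition is_left_module (l : bounded_bilinear A B B) :=
  forall a a' b, l (mul a a') b = l a (l a' b).

Definition is_right_module (r : bounded_bilinear B A B) :=
  forall b a a', r b (mul a a') = r (r b a) a'.

(* The usual compatibility a(ba') = (ab)a' of the two actions is not imposed. *)
Definition is_unital_module (l : bounded_bilinear A B B)
    (r : bounded_bilinear B A B) :=
  [/\ is_left_module l, is_right_module r &
      exists e, forall b, l e b = b /\ r b e = b].

(* The functional b'a'' on B^**: since (adjoint n)(z', x) is z' o n(x, -), this
   is b'' |-> <a''b'', b'>. *)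
Definition dual_act (l : bounded_bilinear A B B) (b' : dual B)
    (a'' : dual (dual A)) : dual (dual (dual B)) :=
  adjoint (arens_ext l) (bidual_embed b') a''.

Lemma dual_actE l b' a'' b'' : dual_act l b' a'' b'' = arens_ext l a'' b'' b'.
Proof. by []. Qed.

End modules.

Definition arens_regular (A : normedModType K) (mul : bounded_bilinear A A A) :=
  forall a b, arens_ext mul a b = arens_ext_t mul a b.

Definition strongly_arens_irregular (A : normedModType K)
    (mul : bounded_bilinear A A A) :=
  left_center mul = range (@bidual_embed A) /\
  right_center mul = range (@bidual_embed A).

End bounded_bilinear.

(* Main.v *)
Require Import Defs.
From HB Require Import structures.
From mathcomp Require Import all_boot all_order all_algebra sesquilinear complex.
From mathcomp Require Import ring lra.
From mathcomp Require Import all_classical all_reals topology normedtype.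
Set Implicit Arguments.
Unset Strict Implicit.
Unset Printing Implicit Defensive.
Import Order.TTheory GRing.Theory Num.Theory.
Import numFieldNormedType.Exports.
Local Open Scope classical_set_scope.
Local Open Scope ring_scope.

(** The first Arens extension carries associativity over to the biduals, so a
product of two elements whose left translations are weak*-continuous again
has a weak*-continuous left translation. In (1) the condition defining [X]
says exactly that [b'' |-> x b''] is weak*-continuous; in (2), left
translation by an element of [A] always is, and [b'' e = b''] gives equality.

(3) and (4) are one statement: if an isometry [i] intertwines an action of [A]
on a space with an action on a larger one, every functional on the smaller
space is [z' o i] by Hahn-Banach, so a left translation that is
weak*-continuous on the larger bidual is so on the smaller one. *)

(** * Hahn-Banach extension over real or complex scalars *)

Section hahn_banach.
Variables (R : realType) (V : lmodType R) (p : V -> R).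
Hypothesis pD : forall x y, p (x + y) <= p x + p y.
Hypothesis pZ : forall (t : R) x, 0 < t -> p (t *: x) = t * p x.

(* Partial functionals are represented by their graphs, which need not be
   assumed functional: linearity and domination by [p] force it. *)
Definition dominated_graph (G : set (V * R)) :=
  (forall t x r y s, G (x, r) -> G (y, s) -> G (t *: x + y, t * r + s)) /\
  (forall x r, G (x, r) -> r <= p x).

(** Homogeneity gives [p 0 = 0]. Two values over the same [x] put their difference, of either sign,
    over [0], where domination makes it at most [0]. *)
Lemma dominated_graph_functional G x r s :
  dominated_graph G -> G (x, r) -> G (x, s) -> r = s.
Proof.
move=> [Glin Gp].
have p0 : p 0 = 0.
  by have := @pZ 2 0 ltac:(lra); rewrite scaler0; lra.
have le a b : G (x, a) -> G (x, b) -> b <= a.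
  move=> Ga Gb; have := Gp _ _ (Glin (-1) _ _ _ _ Ga Gb).
  by rewrite scaleN1r addNr p0; lra.
by move=> Gr Gs; apply/le_anti; rewrite !le.
Qed.

(** Subadditivity bounds every [s - p (y - x0)] by every [p (z + x0) - r], so the supremum of the
    former is an admissible value at [x0]. If [x0] is already in the domain, this reproduces its
    value. *)
Lemma dominated_graph_step G x0 : G !=set0 -> dominated_graph G ->
  exists a, dominated_graph
    [set xr | exists y s t, G (y, s) /\ xr = (y + t *: x0, s + t * a)].
Proof.
move=> [[z0 s0] Gz0] [Glin Gp].
pose S := [set ys.2 - p (ys.1 - x0) | ys in G].
have Sle y s z r : G (y, s) -> G (z, r) -> s - p (y - x0) <= p (z + x0) - r.
  move=> Gy Gz; have := Gp _ _ (Glin 1 _ _ _ _ Gy Gz); rewrite scale1r mul1r.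
  have := pD (y - x0) (z + x0); rewrite addrACA addNr addr0.
  by move=> pyz /le_trans/(_ pyz) h; lra.
have Ssup : has_sup S.
  split; first by exists (s0 - p (z0 - x0)), (z0, s0).
  by exists (p (z0 + x0) - s0) => _ [[y s] Gy <-]; exact: Sle.
have G0 : G (0, 0).
  by have := Glin (-1) _ _ _ _ Gz0 Gz0; rewrite scaleN1r addNr mulN1r addNr.
have GZ t y s : G (y, s) -> G (t *: y, t * s).
  by move=> Gy; have := Glin t _ _ _ _ Gy G0; rewrite !addr0.
exists (sup S); split.
  move=> t _ _ _ _ [y [s [a [Gy [-> ->]]]]] [z [r [b [Gz [-> ->]]]]].
  exists (t *: y + z), (t * s + r), (t * a + b); split; first exact: Glin.
  congr pair; last by ring.
  by rewrite scalerDr scalerDl scalerA addrACA.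
move=> _ _ [y [s [t [Gy [-> ->]]]]].
(* After division by the absolute value of [t], the case of negative [t] uses that [sup S] is an
   upper bound of [S], the positive case that it is the least one. *)
have [t0|t0|->] := ltgtP t 0; last by rewrite scale0r mul0r !addr0 Gp.
- have u0 : 0 < - t by rewrite oppr_gt0.
  have tN0 : t != 0 by rewrite lt_eqF.
  have : (- t)^-1 * s - p ((- t)^-1 *: y - x0) <= sup S.
    apply: sup_upper_bound => //.
    by exists ((- t)^-1 *: y, (- t)^-1 * s) => //; exact: GZ.
  rewrite -(ler_pM2l u0) mulrBr mulrA divff ?oppr_eq0// mul1r -pZ//.
  rewrite scalerBr scalerA divff ?oppr_eq0// scale1r scaleNr opprK; lra.
- have tN0 : t != 0 by rewrite gt_eqF.
  have : sup S <= p (t^-1 *: y + x0) - t^-1 * s.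
    apply: ge_sup; first by case: Ssup.
    by move=> _ [[z r] Gz <-]; apply: Sle => //; exact: GZ.
  rewrite -(ler_pM2l t0) mulrBr mulrA divff// mul1r -pZ//.
  by rewrite scalerDr scalerA divff// scale1r; lra.
Qed.

(** Zorn's lemma is applied to the sets whose union with [G0] is dominated, which makes the union of
    the empty chain admissible too. The one-step extension forces a maximal one to be total. *)
Lemma dominated_graph_extension G0 : G0 !=set0 -> dominated_graph G0 ->
  exists G, [/\ G0 `<=` G, dominated_graph G & forall x, exists r, G (x, r)].
Proof.
move=> G0n0 G0dom.
have [F FP Ftot|G [Gdom Gmax]] :=
    @Zorn_bigcup _ [set G | dominated_graph (G0 `|` G)].
  split=> [t x r y s|x r [|[G FG Gx]]]; last 2 first.
  - exact: (proj2 G0dom).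
  - by apply: (proj2 (FP _ FG)); right.
  move=> Gx Gy.
  (* The chain is totally ordered, so two points of the union share one member of it, unless both
     come from [G0]. *)
  have [[H [FH Hx Hy]]|H] : (exists H, [/\ F H, (G0 `|` H) (x, r) &
      (G0 `|` H) (y, s)]) \/ (G0 (x, r) /\ G0 (y, s)).
  - case: Gx Gy => [Gx|[H FH Hx]] [Gy|[H' FH' Hy]]; first by right.
    + by left; exists H'; split=> //; [left|right].
    + by left; exists H; split=> //; [right|left].
    + have [HH'|H'H] := Ftot _ _ FH FH'; left.
        by exists H'; split=> //; right=> //; exact: HH'.
      by exists H; split=> //; right=> //; exact: H'H.
  - have [?|?] := proj1 (FP _ FH) t _ _ _ _ Hx Hy; first by left.
    by right; exists H.
  - by left; apply: (proj1 G0dom); case: H.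
exists (G0 `|` G); split=> // x.
have Gn0 : G0 `|` G !=set0 by case: G0n0 => z ?; exists z; left.
have [a] := @dominated_graph_step _ x Gn0 Gdom.
set H := [set _ | _] => Hdom.
have GH : G0 `|` G `<=` H.
  move=> [y s] Gy; exists y, s, 0; split=> //.
  by rewrite scale0r mul0r !addr0.
have HG : H `<=` G.
  apply: contrapT => nHG; apply: (Gmax H) => /=.
    by split=> // y Gy; apply: GH; right.
  by rewrite setUidr// => y Gy; apply: GH; left.
have [[y s] Gy] := Gn0.
exists a; right; apply: HG; exists 0, 0, 1; split; last first.
  by rewrite !add0r scale1r mul1r.
by have := proj1 Gdom (-1) _ _ _ _ Gy Gy; rewrite scaleN1r addNr mulN1r addNr.
Qed.

(** The starting graph consists of the pairs [(i u, f u)]; domination makes it single-valued. *)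
Theorem hahn_banach (U : lmodType R) (i : {linear U -> V}) (f : {linear U -> R^o}) :
  (forall u, f u <= p (i u)) ->
  exists g : {linear V -> R^o}, (forall v, g v <= p v) /\ forall u, g (i u) = f u.
Proof.
move=> fp.
have [||G [G0G Gdom Gtot]] := @dominated_graph_extension (range (fun u => (i u, f u))).
- by exists (i 0, f 0), 0.
- split=> [t _ _ _ _ [u _ [<- <-]] [v _ [<- <-]]|_ _ [u _ [<- <-]]]; last exact: fp.
  by exists (t *: u + v) => //; rewrite !linearP.
have [g Gg] := choice Gtot.
have glin : linear (g : V -> R^o).
  move=> t x y; apply: (dominated_graph_functional Gdom (Gg _)).
  exact: (proj1 Gdom).
pose gl : {linear V -> R^o} :=
  HB.pack (g : V -> R^o) (GRing.isLinear.Build _ _ _ _ (g : V -> R^o) glin).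
exists gl; split=> [v|u]; first exact: (proj2 Gdom).
by apply: (dominated_graph_functional Gdom (Gg _)); apply: G0G; exists u.
Qed.

End hahn_banach.

(** * Real parts and restriction of scalars to [R] *)

Definition real_part (R : realType) (c : bool) : scalar_field R c -> R :=
  match c return scalar_field R c -> R with
  | true => @complex.Re R
  | false => id
  end.
Arguments real_part {R c}.

Section real_part.
Variables (R : realType) (c : bool).
Local Notation K := (scalar_field R c).
Implicit Types (k : K) (r : R).

Lemma real_scalarD r s : real_scalar c (r + s) = real_scalar c r + real_scalar c s.
Proof. by case: c => //=; rewrite rmorphD. Qed.

Lemma real_scalarM r s : real_scalar c (r * s) = real_scalar c r * real_scalar c s.
Proof. by case: c => //=; rewrite rmorphM. Qed.

Lemma real_scalar1 : real_scalar c (1 : R) = 1.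
Proof. by case: c. Qed.

Lemma real_partD k k' : real_part (k + k') = real_part k + real_part k'.
Proof. by move: k k'; case: c => //= -[? ?] [? ?]. Qed.

Lemma real_partM r k : real_part (real_scalar c r * k) = r * real_part k.
Proof. by move: k; case: c => //= -[? ?] /=; rewrite mul0r subr0. Qed.

Lemma real_scalarK k : 0 <= k -> real_scalar c (real_part k) = k.
Proof. by move: k; case: c => //= k k0; rewrite RRe_real// ger0_real. Qed.

Lemma le_real_part k k' : k <= k' -> real_part k <= real_part k'.
Proof. by move: k k'; case: c => //= k k'; rewrite lecE => /andP[]. Qed.

Lemma real_part_le_norm k : real_part k <= real_part `|k|.
Proof.
move: k; case: c => /= k; last exact: ler_norm.
apply: le_trans (ler_norm _) _.
by have := normc_ge_Re k; rewrite lecE => /andP[].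
Qed.

Lemma normr_real_scalar r : `|real_scalar c r| = real_scalar c `|r|.
Proof. by case: c => //=; rewrite normc_def /= expr0n/= addr0 sqrtr_sqr. Qed.

End real_part.

(** A separate name for the carrier keeps its [R]-module structure apart from the one over
    [scalar_field R c]. *)
Definition realification (R : realType) (c : bool)
  (V : lmodType (scalar_field R c)) : Type := V.

Section realification.
Variables (R : realType) (c : bool) (V : lmodType (scalar_field R c)).

HB.instance Definition _ := GRing.Zmodule.on (realification V).

Let scale (r : R) (x : realification V) : realification V :=
  real_scalar c r *: (x : V).

Let scaleA a b x : scale a (scale b x) = scale (a * b) x.
Proof. by rewrite /scale scalerA real_scalarM. Qed.

Let scale1 : left_id 1 scale.
Proof. by move=> x; rewrite /scale real_scalar1 scale1r. Qed.

Let scaleDr : right_distributive scale +%R.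
Proof. by move=> r x y; exact: scalerDr. Qed.

Let scaleDl x : {morph scale^~ x : a b / a + b}.
Proof. by move=> a b; rewrite /scale real_scalarD scalerDl. Qed.

HB.instance Definition _ := GRing.Zmodule_isLmodule.Build R (realification V)
  scaleA scale1 scaleDr scaleDl.

Lemma realification_scaleE (r : R) (x : realification V) :
  r *: x = real_scalar c r *: (x : V).
Proof. by []. Qed.

End realification.

(** * Recovering a functional from its real part *)

Section dual_real_part.
Variables (R : realType) (c : bool) (E : normedModType (scalar_field R c)).

(** In the complex case the imaginary part is determined as well, by Im h(x) = - Re h(ix). *)
Lemma dual_real_part_inj (f g : dual E) :
  (forall x, real_part (f x) = real_part (g x)) -> f = g.
Proof.
move=> fg; apply: dual_ext => x; move: E f g fg x; case: c => F f g fg x; last exact: fg.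
have ImE (h : @dual R true F) : complex.Im (h x) = - complex.Re (h ('i%C *: x)).
  by rewrite linearZ/= [_ *: _]mulrC ReiNIm opprK.
apply/eqP; rewrite eq_complex !ImE; apply/andP; split; apply/eqP; first exact: fg.
by congr (- _); exact: fg.
Qed.

(** In the complex case the functional is f(x) = u(x) - i u(ix). *)
Lemma dual_of_real_part (u : {linear realification E -> R^o}) (M : R) :
  (forall x, u x <= M * real_part `|x : E|) ->
  exists f : dual E, forall x, real_part (f x) = u x.
Proof.
move=> uM.
have {}uM x : `|u x| <= M * real_part `|x : E|.
  by rewrite ler_norml uM andbT lerNl -linearN (le_trans (uM _))// normrN.
move: E u uM; case: c => F u uM; last first.
  have fP : (u : F -> R^o) \in @continuous_linear R false F.
    by apply: (@bounded_dual R false F _ M) => // a x y; rewrite -linearP.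
  by exists (Dual fP).
pose f (x : F) : R[i]^o := (u x +i* - u ('i%C *: x))%C.
have flin : linear f.
  move=> [a b] x y; rewrite /f.
  have uZ (s t : R) z : u ((s +i* t)%C *: z : F) = s * u z + t * u ('i%C *: z : F).
    rewrite (_ : (s +i* t)%C *: z =
        s *: (z : realification F) + t *: ('i%C *: z : realification F)).
      by rewrite linearD !linearZ.
    transitivity (real_scalar true s *: z + (real_scalar true t * 'i%C) *: z).
      rewrite -scalerDl; congr (_ *: _); apply/eqP; rewrite eq_complex/=.
      by apply/andP; split; apply/eqP; ring.
    by rewrite -scalerA.
  have uD (z z' : F) : u (z + z') = u z + u z' by exact: linearD.
  rewrite scalerDr scalerA !uD.
  have -> : 'i%C * (a +i* b)%C = (- b +i* a)%C :> R[i].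
    by apply/eqP; rewrite eq_complex/=; apply/andP; split; apply/eqP; ring.
  rewrite (uZ a b x) (uZ (- b) a x); apply/eqP; rewrite eq_complex/=.
  by apply/andP; split; apply/eqP; ring.
have normi : `|'i%C : R[i]| = 1.
  by rewrite normc_def /= expr0n/= expr1n add0r sqrtr1.
(* The real and imaginary parts contribute [M] each, since multiplication by i preserves the
   norm. *)
have fP : f \in @continuous_linear R true F.
  apply: (@bounded_dual R true F _ ((M + M)%:C)%C) => // x.
  have -> : f x = (u x)%:C%C + 'i%C * (- u ('i%C *: x))%:C%C.
    by rewrite [LHS]complexE.
  rewrite (le_trans (ler_normD _ _))// rmorphD mulrDl normrM normi mul1r.
  rewrite !(normr_real_scalar true) normrN.
  have le (y : F) : (`|u y|%:C <= M%:C * `|y|)%C.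
    by rewrite -(real_scalarK (normr_ge0 y)) -rmorphM lecR.
  rewrite lerD// (le_trans (le _))// normrZ normi mul1r//.
by exists (Dual fP).
Qed.

End dual_real_part.

(** The real part of [f] is dominated by a multiple of the norm, and the isometry carries this bound
    over to [F]. Real Hahn-Banach extends it, and the extension is the real part of some [g]. *)
Lemma dual_extension (R : realType) (c : bool)
    (E F : normedModType (scalar_field R c)) (i : {linear E -> F}) (f : dual E) :
  (forall x, `|i x| = `|x|) -> exists g : dual F, forall x, g (i x) = f x.
Proof.
move=> iN; have [M M0 fM] := dual_bounded f.
pose p (y : realification F) : R := M * real_part `|y : F|.
have pD x y : p (x + y) <= p x + p y.
  rewrite -mulrDr ler_wpM2l// -real_partD; apply: le_real_part.
  exact: ler_normD.
have pZ (t : R) x : 0 < t -> p (t *: x) = t * p x.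
  move=> t0; rewrite /p realification_scaleE normrZ normr_real_scalar.
  by rewrite real_partM gtr0_norm// mulrCA.
have ilin : linear (i : realification E -> realification F).
  by move=> t x y; rewrite !realification_scaleE linearP.
have ulin : linear (fun x : realification E => real_part (f x) : R^o).
  by move=> t x y; rewrite realification_scaleE linearP real_partD real_partM.
pose ir : {linear realification E -> realification F} :=
  HB.pack (i : realification E -> realification F)
    (GRing.isLinear.Build _ _ _ _ (i : realification E -> realification F) ilin).
pose u : {linear realification E -> R^o} :=
  HB.pack (fun x : realification E => real_part (f x) : R^o)
    (GRing.isLinear.Build _ _ _ _
      (fun x : realification E => real_part (f x) : R^o) ulin).
have [x|v [vp vu]] := hahn_banach pD pZ (i := ir) (f := u).
  rewrite /p /= iN (le_trans (real_part_le_norm _))//.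
  by rewrite -real_partM le_real_part.
have [g gv] := dual_of_real_part vp.
exists g => x.
(* As an element of [dual E], the restriction of [g] along [i] can be compared with [f] on real
   parts alone. *)
have giP : (fun x => g (i x)) \in continuous_linear E.
  apply: (@bounded_dual _ _ _ _ (dual_norm g)) => [a y z|y]; first by rewrite !linearP.
  by rewrite -(iN y) dual_norm_bound.
suff <- : Dual giP = f by [].
by apply: dual_real_part_inj => y; rewrite /= gv vu.
Qed.

(** * Arens extensions and weak* continuity *)

Section weak_star.
Variables (R : realType) (c : bool).
Local Notation K := (scalar_field R c).
Implicit Types E F G : normedModType K.

Lemma weak_star_eval_continuous E (x : E) :
  continuous ((fun f : dual E => f x) : weak_star E -> K^o).
Proof.
move=> f; pose h (g : weak_star E) : {ptws E -> K^o} := dual_fun g.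
have [|ev _] := @pointwise_cvgP E K^o (h @ f) (dual_fun f).
  exact: (fmap_filter _ (@nbhs_filter (weak_star E) f)).
apply: (ev _ x).
exact: (@initial_continuous _ _ (fun g : dual E => (dual_fun g : {ptws E -> K^o}))).
Qed.

Lemma weak_star_continuousP E F (g : dual E -> dual F) :
  weak_star_continuous g <->
  forall y, continuous ((fun f => g f y) : weak_star E -> K^o).
Proof.
split=> [gc y f|gc].
  apply: (@continuous_comp (weak_star E) (weak_star F) K^o g (fun h => dual_fun h y)).
    exact: gc.
  exact: weak_star_eval_continuous.
apply: continuous_comp_initial => f; apply/pointwise_cvgP => [|y].
  exact: (fmap_filter _ (@nbhs_filter (weak_star E) f)).
exact: gc.
Qed.

Lemma weak_star_continuous_comp E F G (g : dual E -> dual F) (h : dual F -> dual G) :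
  weak_star_continuous g -> weak_star_continuous h -> weak_star_continuous (h \o g).
Proof.
move=> gc hc f.
apply: (@continuous_comp (weak_star E) (weak_star F) (weak_star G)).
  exact: gc.
exact: hc.
Qed.

(** Each coordinate of [g] is then an evaluation, as for the adjoint of a map from [F] to [E]. *)
Lemma weak_star_continuous_preadjoint E F (g : dual E -> dual F) :
  (forall y, exists x, forall f, g f y = f x) -> weak_star_continuous g.
Proof.
move=> gx; apply/weak_star_continuousP => y; have [x gxE] := gx y.
rewrite (_ : (fun f => _) = (fun f : dual E => f x)); last exact/funext.
exact: weak_star_eval_continuous.
Qed.

End weak_star.

(** * First and second adjoints of a contraction *)

Section transpose.
Variables (R : realType) (c : bool) (E F : normedModType (scalar_field R c)).
Variables (i : {linear E -> F}) (iN : forall x, `|i x| <= `|x|).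

Lemma transpose_subproof (f : dual F) : (fun x => f (i x)) \in continuous_linear E.
Proof.
apply: (@bounded_dual _ _ _ _ (dual_norm f)) => [a x y|x]; first by rewrite !linearP.
by rewrite (le_trans (dual_norm_bound _ _))// ler_wpM2l ?dual_norm_ge0.
Qed.

Definition transpose (f : dual F) : dual E := Dual (transpose_subproof f).

Lemma bitranspose_subproof (x : dual (dual E)) :
  (fun f => x (transpose f)) \in continuous_linear (dual F).
Proof.
apply: (@bounded_dual _ _ _ _ (dual_norm x)) => [a f g|f].
  by rewrite -linearP; congr (x _); exact: dual_ext.
rewrite (le_trans (dual_norm_bound _ _))// ler_wpM2l ?dual_norm_ge0//.
apply: dual_norm_le => [|y]; first exact: dual_norm_ge0.
apply: le_trans (dual_norm_bound f (i y)) _.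
by rewrite ler_wpM2l ?dual_norm_ge0.
Qed.

Definition bitranspose (x : dual (dual E)) : dual (dual F) :=
  Dual (bitranspose_subproof x).

Lemma bitranspose_weak_star_continuous : weak_star_continuous bitranspose.
Proof.
by apply: weak_star_continuous_preadjoint => f; exists (transpose f).
Qed.

End transpose.

(** * Associativity, naturality and left centres of Arens extensions *)

Section arens_ext.
Variables (R : realType) (c : bool).
Local Notation K := (scalar_field R c).

(** Both sides apply [x], [y], [z] in this order to [w] at a triple product. Four separate maps let
    one statement cover algebra and module associativity. *)
Lemma arens_ext_assoc (X Y Z U V W : normedModType K)
    (m : bounded_bilinear X Y U) (n : bounded_bilinear U Z W)
    (m' : bounded_bilinear Y Z V) (n' : bounded_bilinear X V W) :
  (forall x y z, n (m x y) z = n' x (m' y z)) ->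
  forall x y z, arens_ext n (arens_ext m x y) z = arens_ext n' x (arens_ext m' y z).
Proof.
move=> mn x y z; apply: dual_ext => w.
congr (dual_fun x _); apply: dual_ext => a.
congr (dual_fun y _); apply: dual_ext => b.
by congr (dual_fun z _); apply: dual_ext => d /=; rewrite mn.
Qed.

Lemma arens_ext_bitranspose (X Y Y' Z Z' : normedModType K)
    (m : bounded_bilinear X Y Z) (n : bounded_bilinear X Y' Z')
    (i : {linear Y -> Y'}) (iN : forall y, `|i y| <= `|y|)
    (j : {linear Z -> Z'}) (jN : forall z, `|j z| <= `|z|) :
  (forall x y, j (m x y) = n x (i y)) ->
  forall x y, arens_ext n x (bitranspose iN y) = bitranspose jN (arens_ext m x y).
Proof.
move=> mn x y; apply: dual_ext => z.
congr (dual_fun x _); apply: dual_ext => a.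
by congr (dual_fun y _); apply: dual_ext => b /=; rewrite mn.
Qed.

(** Translation by an embedded [x] is the second adjoint of [m x]. *)
Lemma bidual_embed_left_center (X Y Z : normedModType K)
    (m : bounded_bilinear X Y Z) (x : X) : left_center m (bidual_embed x).
Proof.
by apply: weak_star_continuous_preadjoint => z; exists (adjoint m z x).
Qed.

(** In the second extension [y] is the outermost functional, so pairing with [z] evaluates [y] at a
    fixed point. Arens regularity transfers this to the first extension. *)
Lemma arens_ext_t_weak_star_continuous (X Y Z : normedModType K)
    (m : bounded_bilinear X Y Z) (x : dual (dual X)) :
  weak_star_continuous (fun y => arens_ext_t m x y).
Proof.
apply: weak_star_continuous_preadjoint => z.
by exists (adjoint (adjoint (flip m)) x z).
Qed.

(** By associativity, translation by the product is translation by [y] followed by translation by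
    [x]. *)
Lemma left_center_comp (X Y Z U V W : normedModType K)
    (m : bounded_bilinear X Y U) (n : bounded_bilinear U Z W)
    (m' : bounded_bilinear Y Z V) (n' : bounded_bilinear X V W) x y :
  (forall x y z, n (m x y) z = n' x (m' y z)) ->
  left_center n' x -> left_center m' y -> left_center n (arens_ext m x y).
Proof.
move=> mn xc yc; rewrite /left_center/=.
rewrite (_ : (fun z => _) = (fun v => arens_ext n' x v) \o (fun z => arens_ext m' y z)).
  exact: weak_star_continuous_comp.
by apply/funext => z; exact: arens_ext_assoc.
Qed.

(** Writing [z] as [z'] composed with [j], the [z]-coordinate of the translate of [y] is the
    [z']-coordinate of the translate of [bitranspose iN y]. *)
Lemma left_center_sub_isometry (X Y Y' Z Z' : normedModType K)
    (m : bounded_bilinear X Y Z) (n : bounded_bilinear X Y' Z')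
    (i : {linear Y -> Y'}) (j : {linear Z -> Z'}) :
  (forall y, `|i y| <= `|y|) -> (forall z, `|j z| = `|z|) ->
  (forall x y, j (m x y) = n x (i y)) -> left_center n `<=` left_center m.
Proof.
move=> iN jN mn x xc; apply/weak_star_continuousP => z.
have jN' u : `|j u| <= `|u| by rewrite jN.
have [z' z'E] := dual_extension z jN.
rewrite (_ : (fun y => _) = (fun y => arens_ext n x (bitranspose iN y) z')).
  have /weak_star_continuousP nc :=
    weak_star_continuous_comp (@bitranspose_weak_star_continuous _ _ _ _ i iN) xc.
  exact: (nc z').
apply/funext => y; rewrite (arens_ext_bitranspose iN jN' mn) /=.
by congr (dual_fun x (adjoint (adjoint m) y _)); apply: dual_ext => u /=.
Qed.

End arens_ext.

Theorem mainTheorem3 (R : realType) (is_complex : bool)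
    (A : completeNormedModType (scalar_field R is_complex))
    (mul : bounded_bilinear A A A) (hA : is_banach_algebra mul) :
  [/\
    forall (B : completeNormedModType (scalar_field R is_complex))
      (l : bounded_bilinear A B B),
      is_left_module mul l ->
      [set arens_ext mul a'' x | a'' in left_center l &
         x in [set x : dual (dual A) | forall b' : dual B,
                 range (@bidual_embed _ _ (dual B)) (dual_act l b' x)]]
      `<=` left_center l,
    forall (B : completeNormedModType (scalar_field R is_complex))
      (r : bounded_bilinear B A B),
      is_right_module mul r ->
      [set arens_ext r b'' a'' | b'' in left_center r & a'' in left_center mul]
      `<=` left_center r /\
      ((exists l : bounded_bilinear A B B, is_unital_module mul l r) ->
       [set arens_ext r b'' a'' | b'' in left_center r & a'' in left_center mul]
       = left_center r),
    forall (B : completeNormedModType (scalar_field R is_complex))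
      (incl : {linear B -> A}) (l : bounded_bilinear A B B),
      (forall b, `|incl b| = `|b|) ->
      is_left_module mul l ->
      (forall a b, incl (l a b) = mul a (incl b)) ->
      arens_regular mul ->
      left_center l = setT
    & forall (B : completeNormedModType (scalar_field R is_complex))
      (incl : {linear A -> B}) (l : bounded_bilinear A B B),
      (forall a, `|incl a| = `|a|) ->
      is_left_module mul l ->
      (forall a a', l a (incl a') = incl (mul a a')) ->
      strongly_arens_irregular mul ->
      left_center l = range (@bidual_embed _ _ A) ].
Proof.
split=> [B l lM _ [a ac [x xX <-]]|B r rM|B i l iN _ il Areg|B i l iN _ il [Z1 _]].
- apply: (left_center_comp (n := l) (m' := l) (n' := l)) => //.
  (* The functional [b1] representing [dual_act l b' x] serves as the preadjoint of translation by
     [x] at [b']. *)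
  apply: weak_star_continuous_preadjoint => b'; have [b1 _ b1E] := xX b'.
  by exists b1 => b''; rewrite -(dual_actE l b' x b'') -b1E.
- have sub : [set arens_ext r b a | b in left_center r & a in left_center mul]
      `<=` left_center r.
    move=> _ [b bc [a ac <-]].
    by apply: (left_center_comp (n := r) (m' := mul) (n' := r)) => // *; rewrite rM.
  split=> // -[l [_ _ [e eP]]]; apply/seteqP; split=> // b bc.
  (* The right factor is the unit, embedded in the bidual; it fixes [b] because b'(y e) = b'(y). *)
  exists b => //; exists (bidual_embed e); first exact: bidual_embed_left_center.
  apply: dual_ext => b'; congr (dual_fun b _); apply: dual_ext => y /=.
  by have [_ ->] := eP y.
- apply/seteqP; split=> // a _.
  (* As [B] sits inside [A], it is enough that [a] lies in the left centre of the multiplication. *)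
  apply: (left_center_sub_isometry _ iN il) => [b|]; first by rewrite iN.
  rewrite /left_center/= (_ : (fun y => _) = (fun y => arens_ext_t mul a y)).
    exact: arens_ext_t_weak_star_continuous.
  exact/funext/Areg.
- apply/seteqP; split=> [a ac|_ [a _ <-]]; last exact: bidual_embed_left_center.
  (* Now [A] sits inside [B], so the inclusion of centres runs from the action to the
     multiplication. *)
  rewrite -Z1; apply: (left_center_sub_isometry _ iN _ ac) => // y.
  by rewrite iN.
Qed.
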